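(* Let $(p_n)_{n\ge0}$ be defined by $p_0=p_1=p_2=0$, $p_3=1$ and $p_n=p_{n-1}+p_{n-2}+p_{n-3}+p_{n-4}$ for $n\ge4$, and let $(q_n)_{n\ge0}$ be defined by $q_0=q_1=q_2=0$, $q_3=1$ and $q_n=q_{n-1}+q_{n-4}$ for $n\ge 4$. Then the ratio $\frac{\sqrt[n]{a_n}}{\sqrt[n-1]{a_{n-1}}}$ is strictly decreasing for all $n\ge5$ when $a_n=p_n$ and for all $n\ge 11$ when $a_n=q_n$; that is, $$\frac{\sqrt[n]{a_n}}{\sqrt[n-1]{a_{n-1}}}>\frac{\sqrt[n+1]{a_{n+1}}}{\sqrt[n]{a_n}}$$ holds for all $n\ge 5$ when $a_n=p_n$, and for all $n\ge 11$ when $a_n=q_n$.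
   Context: For $y\ge 0$ and an integer $n\ge1$, $\sqrt[n]{y}$ denotes the non-negative real $n$-th root. *)

(* Defs.v *)
From mathcomp Require Import all_boot all_order all_algebra.
From mathcomp Require Import all_reals exp.

Set Implicit Arguments.
Unset Strict Implicit.
Unset Printing Implicit Defensive.

Import Order.TTheory GRing.Theory Num.Theory.

Fixpoint p_seq (n : nat) : nat :=
  match n with
  | 0 | 1 | 2 => 0
  | 3 => 1
  | S (S (S ((S n4) as n3) as n2) as n1) =>
      p_seq n1 + p_seq n2 + p_seq n3 + p_seq n4
  end.

Fixpoint q_seq (n : nat) : nat :=
  match n with
  | 0 | 1 | 2 => 0
  | 3 => 1
  | S (S (S (S n4)) as n1) => q_seq n1 + q_seq n4
  end.

Local Open Scope ring_scope.

(* Meant for [0 < n] and [0 <= y], where [nth_rootP] characterizes it;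
   [powR] satisfies [0 `^ x = 0] for [x != 0]. *)
Definition nth_root (R : realType) (n : nat) (y : R) : R := y `^ n%:R^-1.

Lemma nth_rootP (R : realType) (n : nat) (y x : R) :
  (0 < n)%N -> 0 <= y -> x = nth_root n y <-> 0 <= x /\ x ^+ n = y.
Proof.
move=> n_gt0 y_ge0; have n_neq0 : n%:R != 0 :> R by rewrite pnatr_eq0 -lt0n.
split=> [->|[x_ge0 <-]].
  split; first exact: powR_ge0.
  by rewrite -powR_mulrn ?powR_ge0// -powRrM mulVf// powRr1.
by rewrite /nth_root -powR_mulrn// -powRrM mulfV// powRr1.
Qed.

Lemma p_seq_rec (n : nat) : (4 <= n)%N ->
  p_seq n = (p_seq (n - 1) + p_seq (n - 2) + p_seq (n - 3) + p_seq (n - 4))%N.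
Proof. by case: n => [|[|[|[|n]]]] // _; rewrite !subSS !subn0. Qed.

Lemma q_seq_rec (n : nat) : (4 <= n)%N ->
  q_seq n = (q_seq (n - 1) + q_seq (n - 4))%N.
Proof. by case: n => [|[|[|[|n]]]] // _; rewrite !subSS !subn0. Qed.

(* Main.v *)
Require Import Defs.
From mathcomp Require Import all_boot all_order all_algebra.
From mathcomp Require Import all_reals exp.
From mathcomp Require Import ring lra zify.
From Stdlib Require BinNat Nnat.
Import Order.TTheory GRing.Theory Num.Theory.
Local Open Scope ring_scope.

(** Why the theorem holds.  Write [n = m + 1] and [L_k = ln a_k].  Taking
logarithms and clearing denominators, the claim becomes
  [m (m + 1) B_m < 2 G_m],
where [B_m = L_(m+2) - 2 L_(m+1) + L_m] and
[G_m = m L_(m+1) - (m + 1) L_m] ([root_ratio_dropE]).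

If [a_m] behaves like [c alpha^m], then [G_m] tends to [- ln c], a positive
number for both sequences, while [B_m] is the logarithm of
[a_(m+2) a_m / a_(m+1)^2], which tends to 1 exponentially fast.  So the claim
is clear for large [m], and the work is to make this effective without
computing [alpha] or [c].  Two facts do that.

First, [G_(m+1) = G_m + (m + 1) B_m], so that a lower bound on [G] at one index
propagates as long as [B] is summably small.  If the Turan expression
[E_m = a_(m+2) a_m - a_(m+1)^2] satisfies
[2 (m + 1)^2 m |E_m| <= M a_(m+1)^2] from the index [M] on, then [G_M >= 1]
yields [G_m >= M / m] by a telescoping induction, and this dominates the term
[m (m + 1) B_m] ([root_ratio_drop_of_turan]).

Second, [E] satisfies a linear recurrence of order six, whose characteristic
roots are the products of two distinct characteristic roots of [a].  Bounding
the solution through the absolute values of the coefficients gives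
[|E_(M+k)| <= K t^k] ([linear_recurrence_bound]); this loses a lot compared with
the true growth rate, but a rational [t] with [t < s^2] remains available,
where [s] bounds the ratios [a_(m+1) / a_m] from below.  Then [E_m / a_(m+1)^2]
decays geometrically, which beats the cubic factor ([turan_small]).

The starting points are [M = 11] for [p_seq] and [M = 21] for [q_seq]; below
them the inequality between integer powers equivalent to the claim is
evaluated. *)

(** * Logarithmic form of the inequality *)

Definition turan {R : realType} (a : nat -> R) (m : nat) : R :=
  a m.+2 * a m - a m.+1 ^+ 2.

Definition log_defect {R : realType} (a : nat -> R) (m : nat) : R :=
  m%:R * ln (a m.+1) - m.+1%:R * ln (a m).

Definition log_bend {R : realType} (a : nat -> R) (m : nat) : R :=
  ln (a m.+2) - 2 * ln (a m.+1) + ln (a m).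

Definition root_ratio_drop {R : realType} (a : nat -> R) (m : nat) : Prop :=
  nth_root m.+2 (a m.+2) / nth_root m.+1 (a m.+1) <
  nth_root m.+1 (a m.+1) / nth_root m (a m).

Lemma natrS2 (R : realType) (n : nat) : n.+2%:R = n%:R + 2 :> R.
Proof. by rewrite -addn2 natrD. Qed.

(** The logarithm of the quotient of the two sides, multiplied by
[m (m + 1) (m + 2)], is the difference of the two sides below. *)
Lemma root_ratio_dropE (R : realType) (a : nat -> R) (m : nat) :
  (0 < m)%N -> 0 < a m -> 0 < a m.+1 -> 0 < a m.+2 ->
  root_ratio_drop a m <->
  m%:R * m.+1%:R * log_bend a m < 2 * log_defect a m.
Proof.
move=> m_gt0 a0 a1 a2; rewrite /root_ratio_drop /nth_root.
have pos n y : 0 < y -> y `^ n%:R^-1 \is @Num.pos R by move=> ?; exact: powR_gt0.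
rewrite -ltr_ln ?posrE ?divr_gt0 ?powR_gt0//.
rewrite !ln_div ?pos// !ln_powR /log_bend /log_defect.
set x := ln (a m); set y := ln (a m.+1); set z := ln (a m.+2).
have m0 : 0 < m%:R :> R by rewrite ltr0n.
rewrite (natrS2 _ m) -(natr1 m).
set u := m%:R in m0 *.
have D0 : 0 < u * (u + 1) * (u + 2) by rewrite !mulr_gt0// ltr_wpDr.
rewrite -(ltr_pM2l D0) -subr_gt0.
have -> : u * (u + 1) * (u + 2) * ((u + 1)^-1 * y - u^-1 * x) -
    u * (u + 1) * (u + 2) * ((u + 2)^-1 * z - (u + 1)^-1 * y) =
    2 * (u * y - (u + 1) * x) - u * (u + 1) * (z - 2 * y + x).
  field; apply/and3P; split; apply: lt0r_neq0 => //; lra.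
by rewrite subr_gt0.
Qed.

(** This makes it unnecessary to estimate [log_defect] at every index: its
variation is controlled by [log_bend] alone. *)
Lemma log_defectS (R : realType) (a : nat -> R) (m : nat) :
  log_defect a m.+1 = log_defect a m + m.+1%:R * log_bend a m.
Proof.
rewrite /log_defect /log_bend.
rewrite (natrS2 _ m) -(natr1 m).
ring.
Qed.

(** Both bounds come from [ln (1 + y) <= y]: the lower one by applying it to
[1 + y = 1 / (1 + x)]. *)
Lemma ln_1D_bound (R : realType) (x b : R) :
  `|x| <= b -> b <= 1 / 2 -> - (2 * b) <= ln (1 + x) <= b.
Proof.
rewrite ler_norml => /andP[xl xu] b2.
have x1 : 0 < 1 + x by lra.
apply/andP; split; last by apply: le_trans xu; apply: le_ln1Dx; lra.
have lnI : ln (1 + x) = - ln (1 + (- x / (1 + x))).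
  rewrite -lnV ?posrE; last first.
    by rewrite (_ : _ + _ = (1 + x)^-1) ?invr_gt0//; field; lra.
  by congr ln; field; apply/andP; split; lra.
rewrite lnI lerN2.
have l1 : -1 < - x / (1 + x) by rewrite ltr_pdivlMr//; lra.
apply: le_trans (le_ln1Dx l1) _.
by rewrite ler_pdivrMr//; nra.
Qed.

(** The bend is [ln (1 + turan a m / a m.+1 ^+ 2)]. *)
Lemma log_bend_bound (R : realType) (a : nat -> R) (m : nat) (b : R) :
  0 < a m -> 0 < a m.+1 -> 0 < a m.+2 -> b <= 1 / 2 ->
  `|turan a m| <= b * a m.+1 ^+ 2 ->
  - (2 * b) <= log_bend a m <= b.
Proof.
move=> a0 a1 a2 b2 tb.
have sq : 0 < a m.+1 ^+ 2 by rewrite exprn_gt0.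
have -> : log_bend a m = ln (1 + turan a m / a m.+1 ^+ 2).
  have -> : 1 + turan a m / a m.+1 ^+ 2 = a m.+2 * a m / a m.+1 ^+ 2.
    by rewrite /turan; field; lra.
  rewrite ln_div ?posrE ?mulr_gt0// lnM ?posrE// lnXn// /log_bend -mulr_natl.
  by ring.
by apply: ln_1D_bound => //; rewrite normrM normfV (gtr0_norm sq) ler_pdivrMr.
Qed.

Lemma ln2_ge (R : realType) : 1 / 2 <= ln 2 :> R.
Proof.
rewrite -[X in ln X]invrK lnV ?posrE ?invr_gt0//.
have -> : 2^-1 = 1 + (- (1 / 2)) :> R by lra.
have := @le_ln1Dx R (- (1 / 2)); lra.
Qed.

(** The factor 4 is used because [ln 4 = 2 ln 2 >= 1] follows from the crude
estimate [ln2_ge]. *)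
Lemma log_defect_ge1 (R : realType) (a : nat -> R) (m : nat) :
  0 < a m -> 0 < a m.+1 -> 4 * a m ^+ m.+1 <= a m.+1 ^+ m ->
  1 <= log_defect a m.
Proof.
move=> a0 a1; rewrite -ler_ln ?posrE ?mulr_gt0 ?exprn_gt0//.
rewrite lnM ?posrE ?exprn_gt0// !lnXn// => h.
have ln4 : ln 4 = 2 * ln 2 :> R.
  by rewrite (_ : 4 = 2 ^+ 2) ?lnXn ?mulr_natl//; ring.
have := ln2_ge R; rewrite /log_defect !mulr_natl; lra.
Qed.

(** * From small Turan expressions to the inequality *)

(** The hypothesis bounds [log_bend a m] above by [M / (2 (m + 1)^2 m)] and below
by minus twice that, so one step lowers [log_defect] by at most
[M / (m (m + 1)) = M / m - M / (m + 1)]; hence the invariant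
[log_defect a m >= M / m].  In the conclusion, [m (m + 1)] times the bend is at
most [M / (2 (m + 1))], which is less than [2 M / m]. *)
Lemma root_ratio_drop_of_turan (R : realType) (a : nat -> R) (M : nat) :
  (0 < M)%N -> (forall m, (M <= m)%N -> 0 < a m) ->
  1 <= log_defect a M ->
  (forall m, (M <= m)%N ->
    2 * m.+1%:R ^+ 2 * m%:R * `|turan a m| <= M%:R * a m.+1 ^+ 2) ->
  forall m, (M <= m)%N -> root_ratio_drop a m.
Proof.
move=> M0 apos dM small.
pose b m : R := M%:R / (2 * m.+1%:R ^+ 2 * m%:R).
have bend m : (M <= m)%N -> - (2 * b m) <= log_bend a m <= b m.
  move=> Mm; have m0 := leq_trans M0 Mm.
  have D0 : 0 < 2 * m.+1%:R ^+ 2 * m%:R :> R.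
    by rewrite !mulr_gt0 ?exprn_gt0 ?ltr0n.
  apply: log_bend_bound; try by apply: apos; lia.
    rewrite /b ler_pdivrMr//.
    have h1 : 1 <= m.+1%:R ^+ 2 :> R by rewrite exprn_ege1// ler1n.
    have h2 : M%:R <= m%:R :> R by rewrite ler_nat.
    have h3 : 0 < m%:R :> R by rewrite ltr0n.
    nra.
  rewrite /b mulrAC ler_pdivlMr//; have := small _ Mm; lra.
have defect m : (M <= m)%N -> M%:R <= m%:R * log_defect a m.
  elim: m => [|m IH]; first by rewrite leqn0 => /eqP E; rewrite E in M0.
  rewrite leq_eqVlt => /predU1P[<-|]; first by rewrite ler_peMr ?ler0n.
  rewrite ltnS => Mm; have m0 := leq_trans M0 Mm.
  have /andP[+ _] := bend _ Mm; rewrite log_defectS /b.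
  move: (IH Mm).
  set d := log_defect _ _; set g := log_bend _ _ => IHm gl.
  move: gl; rewrite -(natr1 m).
  have : 0 < m%:R :> R by rewrite ltr0n.
  set u := m%:R in IHm * => u0 gl.
  set k := M%:R in IHm gl *.
  have u1 : 0 < u * (u + 1) by nra.
  have g2 : - k <= u * (u + 1) ^+ 2 * g.
    have c0 : 0 <= u * (u + 1) ^+ 2 by rewrite mulr_ge0 ?exprn_ge0; lra.
    apply: le_trans (ler_wpM2l c0 gl).
    rewrite le_eqVlt; apply/orP; left; apply/eqP.
    by field; apply/andP; split; lra.
  rewrite -(ler_pM2l u0); nra.
move=> m Mm; have m0 := leq_trans M0 Mm.
apply/root_ratio_dropE => //; try by apply: apos; lia.
have /andP[_ +] := bend _ Mm; have := defect _ Mm; rewrite /b.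
set d := log_defect _ _; set g := log_bend _ _ => dm gl.
have u0 : 0 < m%:R :> R by rewrite ltr0n.
have v0 : 0 < m.+1%:R :> R by rewrite ltr0n.
have k0 : 0 < M%:R :> R by rewrite ltr0n.
have v1 : m.+1%:R = m%:R + 1 :> R by rewrite natr1.
have g2 : m%:R * m.+1%:R * g <= M%:R / (2 * m.+1%:R).
  apply: le_trans (ler_wpM2l _ gl) _; first by rewrite mulr_ge0// ltW.
  rewrite le_eqVlt; apply/orP; left; apply/eqP.
  by field; apply/andP; split; lra.
apply: le_lt_trans g2 _; rewrite ltr_pdivrMr ?mulr_gt0//.
nra.
Qed.

(** Passing from [m] to [m + 1] multiplies the bound [K t^k] by [t], the square
[a m.+1 ^+ 2] by at least [s ^+ 2], and the weight [(m + 1)^2 m] by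
[(m + 2)^2 / ((m + 1) m)]; the last hypothesis but one says that [s ^+ 2]
wins at [M]. *)
Lemma turan_small (R : realType) (a : nat -> R) (M : nat) (s t K : R) :
  (0 < M)%N -> 0 <= s -> 0 <= t -> (forall m, (M <= m)%N -> 0 < a m) ->
  (forall k, s * a (M + k).+1 <= a (M + k).+2) ->
  (forall k, `|turan a (M + k)| <= K * t ^+ k) ->
  t * M.+2%:R ^+ 2 <= s ^+ 2 * (M%:R * M.+1%:R) ->
  2 * M.+1%:R ^+ 2 * M%:R * K <= M%:R * a M.+1 ^+ 2 ->
  forall m, (M <= m)%N ->
    2 * m.+1%:R ^+ 2 * m%:R * `|turan a m| <= M%:R * a m.+1 ^+ 2.
Proof.
move=> M0 s0 t0 apos grow tbound ratio base m /subnKC <-.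
move: (m - M)%N => k.
have K0 : 0 <= K by have := tbound 0%N; rewrite expr0 mulr1; apply: le_trans.
apply: (@le_trans _ _ (2 * (M + k).+1%:R ^+ 2 * (M + k)%:R * (K * t ^+ k))).
  by apply: ler_wpM2l => //; rewrite !mulr_ge0 ?exprn_ge0 ?ler0n.
elim: k => [|k IH]; first by rewrite expr0 mulr1 addn0.
rewrite addnS.
have E n : n.+1%:R = n%:R + 1 :> R by rewrite natr1.
set n := (M + k)%N in IH *.
have n0 : 1 <= M%:R :> R by rewrite ler1n.
have n1 : M%:R <= n%:R :> R by rewrite ler_nat leq_addr.
(* The ratio condition at [M] persists, as [(m+2)^2 / (m (m+1))] decreases. *)
have ratio_n : t * n.+2%:R ^+ 2 <= s ^+ 2 * (n%:R * n.+1%:R).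
  move: ratio; rewrite !E; set u := M%:R in n0 n1 *; set v := n%:R in n1 *.
  move=> ratio; have uu : 0 < u * (u + 1) by nra.
  rewrite -(ler_pM2l uu).
  have mono : u * (u + 1) * (v + 1 + 1) ^+ 2 <= v * (v + 1) * (u + 1 + 1) ^+ 2.
    rewrite -subr_ge0.
    have -> : v * (v + 1) * (u + 1 + 1) ^+ 2 - u * (u + 1) * (v + 1 + 1) ^+ 2 =
      (v - u) * (3 * u * v + 4 * (u + v) + 4) by ring.
    have [u0 v0] : 0 <= u /\ 0 <= v by split; lra.
    have uv : 0 <= u * v by exact: mulr_ge0.
    by apply: mulr_ge0; [lra | rewrite -(mulrA 3); lra].
  have h1 := ler_wpM2l t0 mono.
  have vv : 0 <= v * (v + 1) by nra.
  have h2 := ler_wpM2l vv ratio.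
  lra.
have gr : s ^+ 2 * a n.+1 ^+ 2 <= a n.+2 ^+ 2.
  have a1 : 0 < a n.+1 by apply: apos; rewrite -addnS leq_addr.
  have a2 : 0 < a n.+2 by apply: apos; rewrite -!addnS leq_addr.
  have g := grow k; rewrite -/n in g.
  by rewrite -exprMn lerXn2r ?nnegrE ?mulr_ge0 ?(ltW a1) ?(ltW a2).
rewrite (exprS t k); have T0 : 0 <= t ^+ k by rewrite exprn_ge0.
move: (t ^+ k) T0 IH => T T0 IH.
have c0 : 0 <= 2 * n.+1%:R * (K * T) by rewrite !mulr_ge0.
have h1 := ler_wpM2l c0 ratio_n.
have h2 := ler_wpM2l (sqr_ge0 s) IH.
have h3 := ler_wpM2l (le_trans ler01 n0) gr.
apply: le_trans (le_trans h2 _); last by move: h3; rewrite mulrCA.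
move: h1; move: (n.+2%:R) (n.+1%:R) (n%:R) => x y z h1.
have -> : 2 * x ^+ 2 * y * (K * (t * T)) = 2 * y * (K * T) * (t * x ^+ 2).
  by ring.
by apply: le_trans h1 _; rewrite le_eqVlt; apply/orP; left; apply/eqP; ring.
Qed.

(** The geometric sequence [K t^k] is a supersolution of the recurrence with
coefficients [|c i|], so it dominates every solution that it dominates
initially. *)
Lemma linear_recurrence_bound (R : realType) (d : nat) (c e : nat -> R) (t K : R) :
  0 <= t -> 0 <= K -> \sum_(i < d) `|c i| * t ^+ i <= t ^+ d ->
  (forall k, e (k + d)%N = \sum_(i < d) c i * e (k + i)%N) ->
  (forall k, (k < d)%N -> `|e k| <= K * t ^+ k) ->
  forall k, `|e k| <= K * t ^+ k.
Proof.
move=> t0 K0 tchar rec init; elim/ltn_ind => k IH.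
case: (ltnP k d) => [/init//|/subnK kE].
move: (k - d)%N kE IH => j <- {k} IH; rewrite rec exprD.
apply: le_trans (ler_norm_sum _ _ _) _.
have KT : 0 <= K * t ^+ j by rewrite mulr_ge0 ?exprn_ge0.
apply: le_trans (_ : \sum_(i < d) K * t ^+ j * (`|c i| * t ^+ i) <= _).
  apply: ler_sum => i _; rewrite normrM mulrCA ler_wpM2l//.
  by rewrite -mulrA -exprD IH ?ltn_add2l.
by rewrite -mulr_sumr mulrA ler_wpM2l.
Qed.

(** * Evaluation at small indices *)

Lemma of_nat_expn (x i : nat) :
  BinNat.N.of_nat (x ^ i)%N =
  BinNat.N.pow (BinNat.N.of_nat x) (BinNat.N.of_nat i).
Proof.
elim: i => [|i IH]; first by rewrite expn0.
by rewrite expnS Nnat.Nat2N.inj_mul IH Nnat.Nat2N.inj_succ BinNat.N.pow_succ_r'.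
Qed.

Lemma of_nat_leb (x y : nat) :
  BinNat.N.leb (BinNat.N.of_nat x) (BinNat.N.of_nat y) = (x <= y)%N.
Proof.
by apply/idP/idP; [move/BinNat.N.leb_le|move=> ?; apply/BinNat.N.leb_le]; lia.
Qed.

Lemma of_nat_ltb (x y : nat) :
  BinNat.N.ltb (BinNat.N.of_nat x) (BinNat.N.of_nat y) = (x < y)%N.
Proof.
by apply/idP/idP; [move/BinNat.N.ltb_lt|move=> ?; apply/BinNat.N.ltb_lt]; lia.
Qed.

(** The exponential of half of the inequality in [root_ratio_dropE].  The powers
have thousands of binary digits, so they are computed with binary numbers;
halving the exponents, by writing them as binomial coefficients, keeps this
cheap. *)
Definition drop_test (a : nat -> nat) (m : nat) : bool :=
  let pow k i := BinNat.N.pow (BinNat.N.of_nat (a k)) (BinNat.N.of_nat i) in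
  [&& 0 < a m, 0 < a m.+1, 0 < a m.+2 &
    BinNat.N.ltb (BinNat.N.mul (pow m.+2 'C(m.+1, 2)) (pow m 'C(m.+2, 2)))
                 (pow m.+1 (m * m.+2))]%N.

Definition defect_test (a : nat -> nat) (m : nat) : bool :=
  BinNat.N.leb
    (BinNat.N.mul (BinNat.N.of_nat 4)
       (BinNat.N.pow (BinNat.N.of_nat (a m)) (BinNat.N.of_nat m.+1)))
    (BinNat.N.pow (BinNat.N.of_nat (a m.+1)) (BinNat.N.of_nat m)).

Lemma drop_testP (R : realType) (a : nat -> nat) (m : nat) :
  (0 < m)%N -> drop_test a m -> @root_ratio_drop R (fun k => (a k)%:R) m.
Proof.
move=> m0; rewrite /drop_test -!of_nat_expn -Nnat.Nat2N.inj_mul of_nat_ltb.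
case/and4P=> a0 a1 a2; rewrite -[Nat.mul _ _]/(_ * _)%N -(ltr_nat R) natrM !natrX.
have ap k i : (0 < a k)%N -> (a k)%:R ^+ i \is @Num.pos R.
  by move=> ?; rewrite posrE exprn_gt0// ltr0n.
rewrite -ltr_ln; [|by rewrite rpredM ?ap|exact: ap].
rewrite lnM; [|exact: ap|exact: ap].
rewrite !lnXn ?ltr0n// -!(mulr_natl (ln _)) natrM => h.
have bin2R n : 2 * 'C(n.+1, 2)%:R = n.+1%:R * n%:R :> R.
  by rewrite -!natrM mulnC (bin_ffact _ 2) ffactnS ffactn1.
have b1 := bin2R m; have b2 := bin2R m.+1.
apply/root_ratio_dropE; rewrite ?ltr0n//.
rewrite /log_bend /log_defect.
move: h b1 b2; move: ('C(m.+2, 2)%:R) ('C(m.+1, 2)%:R) => c2 c1.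
rewrite (natrS2 _ m) -(natr1 m).
move=> h b1 b2; have E1 : c1 = (m%:R + 1) * m%:R / 2 by lra.
have E2 : c2 = (m%:R + 2) * (m%:R + 1) / 2 by lra.
by rewrite E1 E2 in h; lra.
Qed.

Lemma defect_testP (R : realType) (a : nat -> nat) (m : nat) :
  (0 < a m)%N -> (0 < a m.+1)%N -> defect_test a m ->
  1 <= @log_defect R (fun k => (a k)%:R) m.
Proof.
move=> a0 a1; rewrite /defect_test -!of_nat_expn -Nnat.Nat2N.inj_mul of_nat_leb.
rewrite -[Nat.mul _ _]/(_ * _)%N -(ler_nat R) natrM !natrX => h.
by apply: log_defect_ge1; rewrite ?ltr0n.
Qed.

(** * The two sequences *)

Lemma p_seq_gt0 (n : nat) : (0 < p_seq n.+3)%N.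
Proof. by elim: n => // n IH; rewrite /= !addn_gt0 IH. Qed.

Lemma q_seq_gt0 (n : nat) : (0 < q_seq n.+3)%N.
Proof. by elim: n => // n IH; rewrite /= addn_gt0 IH. Qed.

Lemma nat_ind4 (P : nat -> Prop) :
  P 0%N -> P 1%N -> P 2%N -> P 3%N ->
  (forall n, P n -> P n.+1 -> P n.+2 -> P n.+3 -> P n.+4) -> forall n, P n.
Proof.
move=> P0 P1 P2 P3 PS n.
suff [] : [/\ P n, P n.+1, P n.+2 & P n.+3] by [].
by elim: n => [|n [? ? ? ?]]; split=> //; apply: PS.
Qed.

(** The estimates below are proved for an abstract real sequence with the
recurrence of [p_seq] and four of its values, rather than for
[fun n => (p_seq n)%:R]: arithmetic on an unknown [a] cannot unfold the
recursive definition, and later values follow from the recurrence in [R]. *)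
Definition p_seq_like {R : realType} (a : nat -> R) : Prop :=
  (forall n, a n.+4 = a n.+3 + a n.+2 + a n.+1 + a n) /\
  [/\ a 8%N = 15, a 9%N = 29, a 10%N = 56 & a 11%N = 108].

Lemma p_seq_likeP (R : realType) : @p_seq_like R (fun n => (p_seq n)%:R).
Proof. by split=> [n|]; [rewrite -!natrD | split]. Qed.

Lemma p_seq_values (R : realType) (a : nat -> R) : p_seq_like a ->
  [/\ a 12%N = 208, a 13%N = 401, a 14%N = 773, a 15%N = 1490 &
  [/\ a 16%N = 2872, a 17%N = 5536 & a 18%N = 10671]].
Proof.
move=> [rec [a8 a9 a10 a11]].
have a12 : a 12%N = 208.
  by rewrite (rec 8%N) a11 a10 a9 a8; ring.
have a13 : a 13%N = 401.
  by rewrite (rec 9%N) a12 a11 a10 a9; ring.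
have a14 : a 14%N = 773.
  by rewrite (rec 10%N) a13 a12 a11 a10; ring.
have a15 : a 15%N = 1490.
  by rewrite (rec 11%N) a14 a13 a12 a11; ring.
have a16 : a 16%N = 2872.
  by rewrite (rec 12%N) a15 a14 a13 a12; ring.
have a17 : a 17%N = 5536.
  by rewrite (rec 13%N) a16 a15 a14 a13; ring.
have a18 : a 18%N = 10671.
  by rewrite (rec 14%N) a17 a16 a15 a14; ring.
by [].
Qed.

(** The difference [a m.+1 - (9 / 5) a m] obeys the same recurrence, which has
positive coefficients, so its sign persists. *)
Lemma p_seq_growth (R : realType) (a : nat -> R) (k : nat) : p_seq_like a ->
  9 / 5 * a (11 + k).+1%N <= a (11 + k).+2%N.
Proof.
move=> aP; have [a12 a13 a14 a15 [a16 _ _]] := p_seq_values _ _ aP.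
have [rec _] := aP.
elim/nat_ind4: k => [||||k]; rewrite ?addnS ?addn0; try by lra.
have := rec (11 + k).+1%N; have := rec (11 + k).+2%N; lra.
Qed.

(** The characteristic polynomial is the exterior square of
[X^4 - X^3 - X^2 - X - 1]: its roots are the products of two distinct roots of
that quartic. *)
Lemma p_seq_turan_rec (R : realType) (a : nat -> R) (n : nat) : p_seq_like a ->
  turan a (n + 6)%N = - turan a (n + 5)%N - 2 * turan a (n + 4)%N
    - 2 * turan a (n + 3)%N + 2 * turan a (n + 2)%N - turan a (n + 1)%N
    + turan a n.
Proof. by move=> [rec _]; rewrite /turan !addnS addn0 !rec; ring. Qed.

Lemma p_seq_turan_values (R : realType) (a : nat -> R) : p_seq_like a ->
  [/\ turan a 11%N = 44, turan a 12%N = - 17, turan a 13%N = - 39 &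
  [/\ turan a 14%N = - 44, turan a 15%N = 256 & turan a 16%N = - 184]].
Proof.
move=> aP; have [a12 a13 a14 a15 [a16 a17 a18]] := p_seq_values _ _ aP.
have [_ [_ _ _ a11]] := aP.
by rewrite /turan a11 a12 a13 a14 a15 a16 a17 a18; do !split; ring.
Qed.

(** With absolute values the recurrence becomes
[t^6 = t^5 + 2 t^4 + 2 t^3 + 2 t^2 + t + 1], whose positive root is near
2.38, and [t = 5 / 2] stays below [(9 / 5)^2].  The constant 44 is the
initial value. *)
Lemma p_seq_turan_bound (R : realType) (a : nat -> R) (k : nat) : p_seq_like a ->
  `|turan a (11 + k)%N| <= 44 * (5 / 2) ^+ k.
Proof.
move=> aP; have [e0 e1 e2 [e3 e4 e5]] := p_seq_turan_values _ _ aP.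
pose c := nth 0 [:: 1; - 1; 2; - 2; - 2; - 1 : R].
apply: (@linear_recurrence_bound R 6 c (fun k => turan a (11 + k)%N)); rewrite /c.
- lra.
- lra.
- by rewrite !big_ord_recr big_ord0 /= !(normrN, normr0, normr1, normr_nat); lra.
- move=> {}k; rewrite !big_ord_recr big_ord0 /= !addnA addn0.
  by rewrite p_seq_turan_rec//; ring.
- case=> [|[|[|[|[|[|//]]]]]] _;
    rewrite ?addnS addn0 ?(e0, e1, e2, e3, e4, e5) ler_norml; lra.
Qed.

(** The counterpart of [p_seq_like], started later because the second largest
characteristic roots of [q_seq] are closer in modulus to the dominant one. *)
Definition q_seq_like {R : realType} (a : nat -> R) : Prop :=
  (forall n, a n.+4 = a n.+3 + a n) /\
  [/\ a 18%N = 69, a 19%N = 95, a 20%N = 131 & a 21%N = 181].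

Lemma q_seq_likeP (R : realType) : @q_seq_like R (fun n => (q_seq n)%:R).
Proof. by split=> [n|]; [rewrite -!natrD | split]. Qed.

Lemma q_seq_values (R : realType) (a : nat -> R) : q_seq_like a ->
  [/\ a 22%N = 250, a 23%N = 345, a 24%N = 476, a 25%N = 657 &
  [/\ a 26%N = 907, a 27%N = 1252 & a 28%N = 1728]].
Proof.
move=> [rec [a18 a19 a20 a21]].
have a22 : a 22%N = 250.
  by rewrite (rec 18%N) a21 a18; ring.
have a23 : a 23%N = 345.
  by rewrite (rec 19%N) a22 a19; ring.
have a24 : a 24%N = 476.
  by rewrite (rec 20%N) a23 a20; ring.
have a25 : a 25%N = 657.
  by rewrite (rec 21%N) a24 a21; ring.
have a26 : a 26%N = 907.
  by rewrite (rec 22%N) a25 a22; ring.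
have a27 : a 27%N = 1252.
  by rewrite (rec 23%N) a26 a23; ring.
have a28 : a 28%N = 1728.
  by rewrite (rec 24%N) a27 a24; ring.
by [].
Qed.

Lemma q_seq_growth (R : realType) (a : nat -> R) (k : nat) : q_seq_like a ->
  11 / 8 * a (21 + k).+1%N <= a (21 + k).+2%N.
Proof.
move=> aP; have [a22 a23 a24 a25 [a26 _ _]] := q_seq_values _ _ aP.
have [rec _] := aP.
elim/nat_ind4: k => [||||k]; rewrite ?addnS ?addn0; try by lra.
have := rec (21 + k).+1%N; have := rec (21 + k).+2%N; lra.
Qed.

(** Here the exterior square is that of [X^4 - X^3 - 1]. *)
Lemma q_seq_turan_rec (R : realType) (a : nat -> R) (n : nat) : q_seq_like a ->
  turan a (n + 6)%N = - turan a (n + 4)%N - turan a (n + 3)%N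
    + turan a (n + 2)%N + turan a n.
Proof. by move=> [rec _]; rewrite /turan !addnS addn0 !rec; ring. Qed.

Lemma q_seq_turan_values (R : realType) (a : nat -> R) : q_seq_like a ->
  [/\ turan a 21%N = - 55, turan a 22%N = - 25, turan a 23%N = 89 &
  [/\ turan a 24%N = 83, turan a 25%N = - 85 & turan a 26%N = - 208]].
Proof.
move=> aP; have [a22 a23 a24 a25 [a26 a27 a28]] := q_seq_values _ _ aP.
have [_ [_ _ _ a21]] := aP.
by rewrite /turan a21 a22 a23 a24 a25 a26 a27 a28; do !split; ring.
Qed.

(** Now [t^6 = t^4 + t^3 + t^2 + 1] has its positive root near [3 / 2], and
[t = 8 / 5] stays below [(11 / 8)^2 = 121 / 64]. *)
Lemma q_seq_turan_bound (R : realType) (a : nat -> R) (k : nat) : q_seq_like a ->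
  `|turan a (21 + k)%N| <= 55 * (8 / 5) ^+ k.
Proof.
move=> aP; have [e0 e1 e2 [e3 e4 e5]] := q_seq_turan_values _ _ aP.
pose c := nth 0 [:: 1; 0; 1; - 1; - 1; 0 : R].
apply: (@linear_recurrence_bound R 6 c (fun k => turan a (21 + k)%N)); rewrite /c.
- lra.
- lra.
- by rewrite !big_ord_recr big_ord0 /= !(normrN, normr0, normr1, normr_nat); lra.
- move=> {}k; rewrite !big_ord_recr big_ord0 /= !addnA addn0.
  by rewrite q_seq_turan_rec//; ring.
- case=> [|[|[|[|[|[|//]]]]]] _;
    rewrite ?addnS addn0 ?(e0, e1, e2, e3, e4, e5) ler_norml; lra.
Qed.

Lemma p_seq_tests (m : nat) : (4 <= m < 11)%N -> drop_test p_seq m.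
Proof.
have /allP tests : all (drop_test p_seq) (iota 4 7) by vm_compute.
by move=> m_in; apply: tests; rewrite mem_iota.
Qed.

Lemma p_seq_drop (R : realType) (m : nat) :
  (4 <= m)%N -> @root_ratio_drop R (fun k => (p_seq k)%:R) m.
Proof.
move=> m_ge; have aP := p_seq_likeP R.
have pos k : (3 <= k)%N -> (0 < p_seq k)%N by move=> /subnKC <-; exact: p_seq_gt0.
case: (ltnP m 11) => [m_lt|].
  apply: (@drop_testP R p_seq m); first exact: leq_trans m_ge.
  by apply: p_seq_tests; rewrite m_ge.
have posR k : (11 <= k)%N -> 0 < (p_seq k)%:R :> R.
  by move=> ?; rewrite ltr0n pos//; lia.
move: m {m_ge}; apply: root_ratio_drop_of_turan => //.
  by apply: (@defect_testP R p_seq); [exact: pos | exact: pos | vm_compute].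
apply: (@turan_small R _ 11 (9 / 5) (5 / 2) 44) => //; try by lra.
- by move=> k; exact: (p_seq_growth _ _ _ aP).
- by move=> k; exact: (p_seq_turan_bound _ _ _ aP).
- have [a12 _ _ _ _] := p_seq_values _ _ aP.
  by rewrite a12; lra.
Qed.

Lemma q_seq_tests (m : nat) : (10 <= m < 21)%N -> drop_test q_seq m.
Proof.
have /allP tests : all (drop_test q_seq) (iota 10 11) by vm_compute.
by move=> m_in; apply: tests; rewrite mem_iota.
Qed.

Lemma q_seq_drop (R : realType) (m : nat) :
  (10 <= m)%N -> @root_ratio_drop R (fun k => (q_seq k)%:R) m.
Proof.
move=> m_ge; have aP := q_seq_likeP R.
have pos k : (3 <= k)%N -> (0 < q_seq k)%N by move=> /subnKC <-; exact: q_seq_gt0.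
case: (ltnP m 21) => [m_lt|].
  apply: (@drop_testP R q_seq m); first exact: leq_trans m_ge.
  by apply: q_seq_tests; rewrite m_ge.
have posR k : (21 <= k)%N -> 0 < (q_seq k)%:R :> R.
  by move=> ?; rewrite ltr0n pos//; lia.
move: m {m_ge}; apply: root_ratio_drop_of_turan => //.
  by apply: (@defect_testP R q_seq); [exact: pos | exact: pos | vm_compute].
apply: (@turan_small R _ 21 (11 / 8) (8 / 5) 55) => //; try by lra.
- by move=> k; exact: (q_seq_growth _ _ _ aP).
- by move=> k; exact: (q_seq_turan_bound _ _ _ aP).
- have [a22 _ _ _ _] := q_seq_values _ _ aP.
  by rewrite a22; lra.
Qed.

Theorem theorem3p3 (R : realType) :
  (forall n : nat, (5 <= n)%N ->
     nth_root n (p_seq n)%:R / nth_root (n - 1) (p_seq (n - 1))%:R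
       > nth_root (n + 1) (p_seq (n + 1))%:R / nth_root n (p_seq n)%:R :> R) /\
  (forall n : nat, (11 <= n)%N ->
     nth_root n (q_seq n)%:R / nth_root (n - 1) (q_seq (n - 1))%:R
       > nth_root (n + 1) (q_seq (n + 1))%:R / nth_root n (q_seq n)%:R :> R).
Proof.
split; case=> // m m_ge; rewrite subn1 addn1.
  exact: p_seq_drop.
exact: q_seq_drop.
Qed.
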